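(* Let $X$ be a locally connected paracompact Hausdorff space. Then there is a canonical split surjection from the set of isomorphism classes of topological $\mathbb{T}$-vector bundles of rank $n$ on $X$ to the set of isomorphism classes of $n$-fold covering spaces of $X$. Furthermore, a topological $\mathbb{T}$-vector bundle is trivial if and only if its associated covering space (its image under this map) is trivial.
   Context: $\mathbb{T}=\mathbb{R}\cup\{-\infty\}$ is the tropical semifield: its addition is $\max$ and its multiplication is addition of real numbers, with $-\infty$ as zero element; the multiplicative identity is the real number $0$. It carries the Euclidean topology (as $[-\infty,\infty)$). A topological $\mathbb{T}$-vector bundle (of rank $n$) on $X$ is a topological space $E$ with a continuous map $\pi:E\to X$ such that every $x\in X$ has an open neighborhood $U_x$ with $\pi^{-1}(U_x)$ homeomorphic over $U_x$ to $U_x\times\mathbb{T}^n$, with $\mathbb{T}$-linear transition maps. Isomorphisms are homeomorphisms over $X$ which are $\mathbb{T}$-linear on fibers. The canonical map: an invertible matrix $A\in\mathrm{GL}_n(\mathbb{T})$ has exactly one nonzero entry (i.e. entry $\neq-\infty$) in each column, and there is a unique permutation $\sigma\in S_n$ with $A_{\sigma(i)i}\neq -\infty$ for all $i$; $A\mapsto\sigma$ is a group homomorphism $\mathrm{GL}_n(\mathbb{T})\to S_n$. Applying it to the transition functions of a topological $\mathbb{T}$-vector bundle of rank $n$ gives $S_n$-valued transition functions, hence a fiber bundle with discrete fiber of $n$ elements, i.e. an $n$-fold covering space of $X$ (the associated covering space). Split means that the map has a right inverse. *)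

(* Defs.v *)
(* MathComp / MathComp-Analysis *)
From HB Require Import structures.
From mathcomp Require Import all_boot all_order all_algebra all_fingroup.
From mathcomp Require Import all_classical all_reals all_analysis.

Set Implicit Arguments.
Unset Strict Implicit.
Unset Printing Implicit Defensive.

Import Order.TTheory GRing.Theory Num.Theory.

Local Open Scope classical_set_scope.
Local Open Scope ring_scope.

(* The tropical semifield [-oo, +oo), as a subtype (and subspace) of \bar R;
   0 and 1 of this semiring are -oo and the real number 0. *)
Record trop (R : realType) := Trop {
  trop_val : \bar R;
  trop_neqy : trop_val != +oo%E }.

HB.instance Definition _ (R : realType) := [isSub for @trop_val R].
HB.instance Definition _ (R : realType) := [Choice of trop R by <:].
HB.instance Definition _ (R : realType) :=
  Topological.copy (trop R) (initial_topology (@trop_val R)).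

Section TropicalSemiring.
Context {R : realType}.
Implicit Types a b c : trop R.

Fact trop_add_neqy a b : Order.max (trop_val a) (trop_val b) != +oo%E.
Proof. by rewrite /Order.max; case: ifP => _; apply: trop_neqy. Qed.
Definition trop_add a b : trop R := Trop (trop_add_neqy a b).

Fact trop_mul_neqy a b : (trop_val a + trop_val b)%E != +oo%E.
Proof. by case: a b => [[r| |] //= _] [[s| |] //= _]. Qed.
Definition trop_mul a b : trop R := Trop (trop_mul_neqy a b).

Definition trop_zero : trop R := @Trop R -oo%E isT.
Definition trop_one : trop R := @Trop R 0%E isT.

Fact trop_addA : associative trop_add.
Proof. by move=> a b c; apply: val_inj; rewrite /= maxA. Qed.
Fact trop_addC : commutative trop_add.
Proof. by move=> a b; apply: val_inj; rewrite /= maxC. Qed.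
Fact trop_add0 : left_id trop_zero trop_add.
Proof. by move=> a; apply: val_inj; rewrite /= max_r ?leNye. Qed.
Fact trop_mulA : associative trop_mul.
Proof. by move=> a b c; apply: val_inj; rewrite /= addeA. Qed.
Fact trop_mulC : commutative trop_mul.
Proof. by move=> a b; apply: val_inj; rewrite /= addeC. Qed.
Fact trop_mul1 : left_id trop_one trop_mul.
Proof. by move=> a; apply: val_inj; rewrite /= add0e. Qed.
Fact trop_mulDl : left_distributive trop_mul trop_add.
Proof.
move=> a b c; apply: val_inj => /=.
have c_ay : trop_val c != +oo%E := trop_neqy c.
case: (leP (trop_val a) (trop_val b)) => ab.
  by rewrite max_r // leeD2r.
by rewrite max_l // leeD2r // ltW.
Qed.
Fact trop_mul0 : left_zero trop_zero trop_mul.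
Proof. by move=> a; apply: val_inj. Qed.
Fact trop_one_neq0 : trop_one != trop_zero.
Proof. by []. Qed.

HB.instance Definition _ :=
  GRing.isNmodule.Build (trop R) trop_addA trop_addC trop_add0.
HB.instance Definition _ :=
  GRing.Nmodule_isComNzSemiRing.Build (trop R)
    trop_mulA trop_mulC trop_mul1 trop_mulDl trop_mul0 trop_one_neq0.

End TropicalSemiring.

Definition trop_linear (R : realType) (m n : nat)
    (f : 'cV[trop R]_m -> 'cV[trop R]_n) : Prop :=
  scalable f /\ {morph f : u v / u + v}.

(* GL_n(T) -> S_n: the permutation s with A (s i) i <> -oo for all i; matrices
   for which there is no such permutation are sent to 1. *)
Definition gl_perm (R : realType) (n : nat) (A : 'M[trop R]_n) : 'S_n :=
  odflt 1%g [pick s : 'S_n | [forall i, A (s i) i != 0]].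

Definition locally_connected (X : topologicalType) : Prop :=
  forall (x : X) (A : set X), nbhs x A ->
    exists B : set X, [/\ open B, B x, connected B & B `<=` A].

Definition paracompact (X : topologicalType) : Prop :=
  forall C : set (set X),
    C `<=` open -> \bigcup_(A in C) A = setT ->
    exists D : set (set X),
      [/\ D `<=` open,
          \bigcup_(B in D) B = setT,
          forall B, D B -> exists2 A, C A & B `<=` A &
          forall x : X, exists2 N, nbhs x N &
            finite_set [set B | D B /\ B `&` N !=set0]].

(* A homeomorphism over U between p^-1(U) and U x F. Both directions are total
   functions, whose values outside p^-1(U) and U x F are irrelevant. *)
Record local_triv (X E F : topologicalType) (p : E -> X) := LocalTriv {
  dom : set X;
  to_prod : E -> X * F;
  of_prod : X * F -> E;
  dom_open : open dom;
  to_prod_continuous : {within p @^-1` dom, continuous to_prod};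
  of_prod_continuous : {within dom `*` setT, continuous of_prod};
  to_prod_over : forall e, dom (p e) -> (to_prod e).1 = p e;
  of_prod_over : forall z, dom z.1 -> p (of_prod z) = z.1;
  to_prodK : forall e, dom (p e) -> of_prod (to_prod e) = e;
  of_prodK : forall z, dom z.1 -> to_prod (of_prod z) = z }.

Definition homeo_over (X E E' : topologicalType) (p : E -> X) (p' : E' -> X)
    (f : E -> E') : Prop :=
  [/\ continuous f,
      exists g : E' -> E, [/\ continuous g, cancel f g & cancel g f] &
      forall e, p' (f e) = p e].

(* The map of fibres over x induced by f, read in two trivializations. *)
Definition fibre_map (X E E' F : topologicalType) (p : E -> X) (p' : E' -> X)
    (phi : local_triv F p) (psi : local_triv F p') (f : E -> E') (x : X)
    (v : F) : F :=
  (to_prod psi (f (of_prod phi (x, v)))).2.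

(* psi o phi^-1 on the fibre over x *)
Definition transition (X E F : topologicalType) (p : E -> X)
    (phi psi : local_triv F p) (x : X) : F -> F :=
  fibre_map phi psi id x.

(* The T-linear structure of the fibres is the one transported along the charts
   of the atlas. *)
Record tbundle (R : realType) (X : topologicalType) (n : nat) := TBundle {
  tb_total : topologicalType;
  tb_proj : tb_total -> X;
  tb_proj_continuous : continuous tb_proj;
  tb_atlas : set (local_triv 'cV[trop R]_n tb_proj);
  tb_atlas_cover : forall x : X, exists2 phi, tb_atlas phi & dom phi x;
  tb_atlas_linear : forall phi psi, tb_atlas phi -> tb_atlas psi ->
    forall x, dom phi x -> dom psi x -> trop_linear (transition phi psi x) }.

Definition tb_iso (R : realType) (X : topologicalType) (n : nat)
    (E E' : tbundle R X n) : Prop :=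
  exists2 f : tb_total E -> tb_total E',
    homeo_over (@tb_proj _ _ _ E) (@tb_proj _ _ _ E') f &
    forall phi psi, tb_atlas phi -> tb_atlas psi ->
      forall x, dom phi x -> dom psi x -> trop_linear (fibre_map phi psi f x).

Record covering (X : topologicalType) (n : nat) := Covering {
  cov_total : topologicalType;
  cov_proj : cov_total -> X;
  cov_proj_continuous : continuous cov_proj;
  cov_triv : forall x : X,
    exists phi : local_triv (discrete_topology 'I_n) cov_proj, dom phi x }.

Definition cov_iso (X : topologicalType) (n : nat) (Y Y' : covering X n) :
    Prop :=
  exists f : cov_total Y -> cov_total Y',
    homeo_over (@cov_proj _ _ Y) (@cov_proj _ _ Y') f.

Section TrivialBundles.
Variables (X F : topologicalType).

Definition prod_triv : local_triv F (fst : X * F -> X).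
Proof.
apply: (@LocalTriv X (X * F)%type F fst setT id id) => //.
- exact: openT.
- by apply: continuous_subspaceT => z.
- by apply: continuous_subspaceT => z.
Defined.

End TrivialBundles.

Definition trivial_tbundle (R : realType) (X : topologicalType) (n : nat) :
  tbundle R X n.
Proof.
apply: (@TBundle R X n (X * 'cV[trop R]_n)%type fst _ [set prod_triv X _]).
- by move=> z; apply: cvg_fst.
- by move=> x; exists (prod_triv X _).
- by move=> _ _ -> -> x _ _.
Defined.

Definition trivial_covering (X : topologicalType) (n : nat) : covering X n.
Proof.
apply: (@Covering X n (X * discrete_topology 'I_n)%type fst).
- by move=> z; apply: cvg_fst.
- by move=> x; exists (prod_triv X _).
Defined.

Definition transition_mx (R : realType) (X E : topologicalType) (n : nat)
    (p : E -> X) (phi psi : local_triv 'cV[trop R]_n p) (x : X) :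
    'M[trop R]_n :=
  \matrix_(i, j) transition phi psi x (delta_mx j 0) i 0.

(* Y is the covering space associated with E: it has trivializations over the
   charts of E whose transition functions are the images in S_n of those of
   E. *)
Definition associated (R : realType) (X : topologicalType) (n : nat)
    (E : tbundle R X n) (Y : covering X n) : Prop :=
  exists t : local_triv 'cV[trop R]_n (@tb_proj _ _ _ E) ->
             local_triv (discrete_topology 'I_n) (@cov_proj _ _ Y),
    (forall phi, tb_atlas phi -> dom (t phi) = dom phi) /\
    (forall phi psi, tb_atlas phi -> tb_atlas psi ->
      forall x, dom phi x -> dom psi x ->
      forall i, transition (t phi) (t psi) x i =
                gl_perm (transition_mx phi psi x) i).

(* Isomorphism classes as subsets of T; "set T" is avoided here because the
   type of all bundles does not fit in the universe of "set". *)
Definition quot (T : Type) (r : T -> T -> Prop) : Type :=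
  {C : T -> Prop | exists x, C = r x}.

Definition cls (T : Type) (r : T -> T -> Prop) (x : T) : quot r :=
  exist _ (r x) (ex_intro _ x erefl).

Definition tbundle_classes (R : realType) (X : topologicalType) (n : nat) :=
  quot (@tb_iso R X n).

Definition covering_classes (X : topologicalType) (n : nat) :=
  quot (@cov_iso X n).

Definition tb_class (R : realType) (X : topologicalType) (n : nat)
    (E : tbundle R X n) : tbundle_classes R X n := cls (@tb_iso R X n) E.

Definition cov_class (X : topologicalType) (n : nat)
    (Y : covering X n) : covering_classes X n := cls (@cov_iso X n) Y.

(* Main.v *)
Require Import Defs.
From HB Require Import structures.
From mathcomp Require Import all_boot all_order all_algebra.
From mathcomp Require Import all_fingroup finmap.
From mathcomp Require Import all_classical all_reals all_analysis.
From mathcomp Require Import lra.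
Import Defs.

(* A T-linear bijection of T^n is monomial: it permutes the coordinate lines and
   rescales them by finite scalars. Transition functions of a T-bundle therefore
   have locally constant permutation parts, which glue a covering; conversely a
   covering acts on T^n by permuting coordinates, which gives the section. If
   the covering is trivial, the lines of the fibres can be numbered globally,
   and what remains of the transition functions is n cocycles of continuous real
   functions. On a paracompact Hausdorff space these are coboundaries, by a
   partition of unity, and rescaling the charts accordingly trivializes the
   bundle. *)

Set Implicit Arguments.
Unset Strict Implicit.
Unset Printing Implicit Defensive.

Import Order.TTheory GRing.Theory Num.Theory.
Import numFieldNormedType.Exports.

Local Open Scope classical_set_scope.
Local Open Scope ring_scope.

(** * Paracompact spaces *)

(** Monomiality comes from the absence of cancellation: a maximum is -oo only if both arguments are,
    and a sum of reals is never -oo. So a zero entry in the product of a matrix with its inverse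
    forces every summand to vanish, which leaves room for only one nonzero entry per column.
    Permutation parts are locally constant because being nonzero is an open condition. Since
    tropical multiplication is real addition, the nonzero scalars are the additive group of R, and
    the scaling factors form additive cocycles with no logarithm taken. They are averaged with real
    weights; the tropical addition takes no part in this. The map on classes is pinned down by the
    relation [associated]: every bundle has an associated covering, and isomorphic bundles have
    isomorphic ones. The section lifts each class separately, by choice, to a bundle with which it
    is associated. *)

Definition locally_finite (X : topologicalType) (D : set (set X)) : Prop :=
  forall x : X,
    exists2 N, nbhs x N & finite_set [set B | D B /\ B `&` N !=set0].

Lemma locally_finite_sub (X : topologicalType) (D D' : set (set X)) :
  D' `<=` D -> locally_finite D -> locally_finite D'.
Proof.
move=> sD lfD x; have [N Nx fN] := lfD x; exists N => //.
by apply: sub_finite_set fN => B [/sD].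
Qed.

Lemma locally_finite_closure (X : topologicalType) (D : set (set X)) :
  locally_finite D ->
  closure (\bigcup_(B in D) B) `<=` \bigcup_(B in D) closure B.
Proof.
move=> lfD x clx; apply: contrapT => nx.
have [N Nx fN] := lfD x.
have : nbhs x (N `&` \bigcap_(B in [set B | D B /\ B `&` N !=set0]) ~` B).
  apply: filterI => //.
  rewrite -(fset_setK fN); apply: filter_bigI => B.
  rewrite in_fset_set // inE => -[DB _].
  apply: (@filterS _ _ _ (~` closure B)); first exact/subsetC/subset_closure.
  apply: open_nbhs_nbhs; split; first exact/closed_openC/closed_closure.
  by move=> clB; apply: nx; exists B.
move=> /clx [y [[B DB By] [Ny yN]]].
by apply: (yN B) => //; split=> //; exists y.
Qed.

Section Paracompact.
Variables (X : topologicalType) (pcX : paracompact X).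

(** Cover X by the given sets [U] and the complement of [A]. In a locally finite refinement the
    members whose closure misses [P] still cover [A], and the closure of their union misses [P].
    With [P] a point this gives regularity, with [P] closed normality. *)
Lemma paracompact_separate (A P : set X) : closed A ->
  (forall a, A a -> exists U, [/\ open U, U a & closure U `&` P = set0]) ->
  exists V, [/\ open V, A `<=` V & closure V `&` P = set0].
Proof.
move=> clA sepA.
have [||D [oD covD refD lfD]] :=
  pcX (C := [set U | open U /\ (closure U `&` P = set0 \/ U = ~` A)]).
- by move=> U [].
- rewrite -subTset => x _; have [Ax|nAx] := pselect (A x); last first.
    by exists (~` A) => //; split; [exact: closed_openC|right].
  by have [U [oU Ux clU]] := sepA _ Ax; exists U => //; split=> //; left.
pose D' := [set B | D B /\ closure B `&` P = set0].
have lfD' : locally_finite D' by apply: locally_finite_sub lfD => B [].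
exists (\bigcup_(B in D') B); split.
- by apply: bigcup_open => B [/oD].
- move=> a Aa; have [B DB Ba] : (\bigcup_(B in D) B) a by rewrite covD.
  exists B => //; split=> //; have [U [oU [clU|UE]] BU] := refD _ DB.
    by rewrite -subset0 -clU; apply: setSI; exact: closureS.
  by have := BU _ Ba; rewrite UE => /(_ Aa).
- rewrite -subset0 => x [/(locally_finite_closure lfD')[B [_ <-] clBx] Px].
  by split.
Qed.

Hypothesis hX : hausdorff_space X.

Lemma paracompact_regular (x : X) (W : set X) : open W -> W x ->
  exists U, [/\ open U, U x & closure U `<=` W].
Proof.
move=> oW Wx; have [|a nWa|V [oV WV clV]] :=
  @paracompact_separate (~` W) [set x]; first exact: open_closedC.
  have /eqP xa : x != a by apply/eqP => xa; apply: nWa; rewrite -xa.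
  have := hX; rewrite open_hausdorff => /(_ x a (introN eqP xa)).
  case=> -[U V] /= [] /set_mem Ux /set_mem Va [oU oV /eqP UV].
  exists V; split=> //; rewrite -subset0 => y [+ /= yx]; rewrite yx => /(_ U).
  case; first exact: open_nbhs_nbhs.
  by move=> z [Vz Uz]; have : (U `&` V) z by []; rewrite UV.
exists (~` closure V); split; first exact/closed_openC/closed_closure.
  by move=> clVx; rewrite -[False]/(set0 x) -clV; split.
apply: (@subset_trans _ (~` V)); last by rewrite -[W]setCK; exact: subsetC.
rewrite [X in _ `<=` X](iffLR (closure_id _)); last exact: open_closedC.
by apply/closureS/subsetC/subset_closure.
Qed.

Lemma paracompact_normal : normal_space X.
Proof.
move=> A clA W /set_nbhsP[G [oG AG GW]].
have [//|a Aa|V [oV AV clV]] := @paracompact_separate A (~` G).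
  have [U [oU Ua clU]] := paracompact_regular oG (AG _ Aa).
  exists U; split=> //. rewrite -subset0 => y. by case=> /clU Gy /(_ Gy).
exists V; first by apply/set_nbhsP; exists V; split.
apply: subset_trans GW => y Vy; apply: contrapT => nGy.
by have : set0 y by rewrite -clV.
Qed.

(** Two refinements are taken: [E] refines the open sets whose closure lies in a member of [D], and
    [V A] collects the members of [E] with closure inside [A]. Local finiteness of [E] keeps the
    closure of [V A] inside [A]. *)
Lemma paracompact_shrink (C : set (set X)) :
  C `<=` open -> \bigcup_(A in C) A = setT ->
  exists D (V : set X -> set X),
    [/\ D `<=` open, locally_finite D,
        forall B, D B -> exists2 A, C A & B `<=` A,
        forall B, D B -> closure (V B) `<=` B &
        \bigcup_(B in D) V B = setT].
Proof.
move=> oC covC; have [D [oD covD refD lfD]] := pcX oC covC.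
have [||E [oE covE refE lfE]] :=
  pcX (C := [set W | open W /\ exists2 A, D A & closure W `<=` A]).
- by move=> W [].
- rewrite -subTset => x _.
  have [A DA Ax] : (\bigcup_(B in D) B) x by rewrite covD.
  have [U [oU Ux clU]] := paracompact_regular (oD _ DA) Ax.
  by exists U => //; split=> //; exists A.
exists D, (fun A => \bigcup_(B in [set B | E B /\ closure B `<=` A]) B).
split=> //.
  move=> A DA; apply: (subset_trans (locally_finite_closure _)).
    by apply: locally_finite_sub lfE => B [].
  by move=> x [B [_ clB]] /clB.
rewrite -subTset => x _.
have [B EB Bx] : (\bigcup_(B in E) B) x by rewrite covE.
have [W [_ [A DA clW]] BW] := refE _ EB.
exists A => //; exists B => //; split=> //.
exact: subset_trans (closureS BW) clW.
Qed.

(** The bumps are not normalized; the division by their sum is left to the averaging. Vanishing near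
    each point outside [B], not merely at it, allows a product with a function that is continuous
    only at the points of [B]. *)
Lemma paracompact_bumps (R : realType) (C : set (set X)) :
  C `<=` open -> \bigcup_(A in C) A = setT ->
  exists D (g : set X -> X -> R),
    [/\ locally_finite D,
        forall B, D B -> exists2 A, C A & B `<=` A,
        forall B, D B ->
          [/\ continuous (g B), forall x, 0 <= g B x &
              forall x, ~ B x -> \forall y \near x, g B y = 0] &
        forall x, exists B, [/\ D B, B x & 0 < g B x]].
Proof.
move=> oC covC.
have [D [V [oD lfD refD clV covV]]] := paracompact_shrink oC covC.
have /choice [f fP] : forall B, exists f : X -> R, D B ->
    [/\ continuous f, forall x, ~ B x -> f x = 0 & forall x, V B x -> f x = 1].
  move=> B; have [DB|nDB] := pselect (D B); last by exists (fun=> 0).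
  have /(@uniform_separatorP _ R) [f [cf _ f0 f1]] :
      uniform_separator (~` B) (closure (V B)).
    apply/(iffLR (@normal_separatorP R X)) => //.
    - exact: paracompact_normal.
    - exact/open_closedC/oD.
    - exact: closed_closure.
    - by rewrite -subset0 => x [nBx /(clV _ DB)].
  exists f => _; split=> // x Hx; first by apply: f0; exists x.
  by apply: f1; exists x => //; apply: subset_closure.
exists D, (fun B x => Num.max 0 (f B x - 2^-1)); split=> //.
  move=> B DB; have [cf f0 f1] := fP B DB; split.
  - move=> x; apply: (@continuous_max _ _ (fun=> 0) (fun x => f B x - 2^-1)).
      exact: cvg_cst.
    by apply: cvgB; [exact: cf|exact: cvg_cst].
  - by move=> x; rewrite le_max lexx.
  - move=> x nBx; have := @cvgr_lt _ _ _ _ _ _ (cf x) 2^-1.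
    rewrite f0 // invr_gt0 ltr0n => /(_ (nbhs_filter x) isT).
    by apply: filterS => y fy; apply/max_idPl; rewrite subr_le0 ltW.
move=> x; have [B DB Vx] : (\bigcup_(B in D) V B) x by rewrite covV.
have [_ _ f1] := fP B DB; exists B; split=> //.
  exact/(clV _ DB)/subset_closure.
rewrite lt_max f1 // orbC subr_gt0 invf_lt1 //; lra.
Qed.

(** Only the members through [x] are summed, finitely many when [D] is locally finite; on an
    infinite index set [fset_set] would default to the empty one. *)
Definition locally_finite_sum (R : realType) (D : set (set X))
    (F : set X -> X -> R) (x : X) : R :=
  \sum_(B <- fset_set [set B | D B /\ B x]) F B x.

Lemma finite_containing (D : set (set X)) (x : X) :
  locally_finite D -> finite_set [set B | D B /\ B x].
Proof.
move=> /(_ x)[N Nx]; apply: sub_finite_set => B [DB Bx]; split=> //.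
by exists x; split=> //; exact: nbhs_singleton.
Qed.

(** The index set varies with the point, but on [N] it may be replaced by the fixed finite set of
    members meeting [N], as [F B] vanishes off [B]. *)
Lemma locally_finite_sum_continuous (R : realType) (D : set (set X))
    (F : set X -> X -> R) (x : X) :
  locally_finite D ->
  (forall B, D B -> {for x, continuous (F B)}) ->
  (forall B y, D B -> ~ B y -> F B y = 0) ->
  {for x, continuous (locally_finite_sum D F)}.
Proof.
move=> lfD cF F0; have [N Nx fN] := lfD x.
have sumE : forall y, N y -> locally_finite_sum D F y =
    \sum_(B <- fset_set [set B | D B /\ B `&` N !=set0]) F B y.
  move=> y Ny; rewrite /locally_finite_sum -!fsbig_finite //; last first.
    exact: finite_containing.
  apply: fsbig_widen => [B [DB By]|B [[DB _] nBy]].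
    by split=> //; exists y.
  by apply: F0 => // By; apply: nBy.
suff : locally_finite_sum D F y @[y --> x] --> locally_finite_sum D F x by [].
rewrite [X in _ --> X](sumE x (nbhs_singleton Nx)).
apply: cvg_trans.
  by apply: near_eq_cvg; apply: filterS Nx => y Ny; exact: esym (sumE y Ny).
rewrite big_seq; under eq_cvg do rewrite big_seq.
apply: (@cvg_big R _ +%R 0); first exact: add_continuous.
by move=> B; rewrite in_fset_set // inE => -[DB _]; exact: cF.
Qed.

(* The cocycle is averaged against a partition of unity. *)
Lemma continuous_cocycle_split (R : realType) (J : Type) (U : J -> set X)
    (a : J -> J -> X -> R) :
  (forall j, open (U j)) -> (forall x, exists j, U j x) ->
  (forall j k x, U j x -> U k x -> {for x, continuous (a j k)}) ->
  (forall j k l x, U j x -> U k x -> U l x -> a j l x = a j k x + a k l x) ->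
  exists b : J -> X -> R,
    (forall j x, U j x -> {for x, continuous (b j)}) /\
    (forall j k x, U j x -> U k x -> b k x = b j x + a j k x).
Proof.
move=> oU covU ca aD.
(* [j0] serves as the default index for sets outside [D]; with no index at all the claim is
   vacuous. *)
have [[j0 _]|noJ] := pselect (exists j : J, True); last first.
  by exists (fun=> fun=> 0); split=> j; case: noJ; exists j.
have [||D [g [lfD refD gD gpos]]] := paracompact_bumps R (C := range U).
- by move=> _ [j _ <-].
- rewrite -subTset => x _; have [j Ujx] := covU x.
  by exists (U j) => //; exists j.
have /choice [i iP] : forall B, exists j, D B -> B `<=` U j.
  move=> B; have [DB|nDB] := pselect (D B); last by exists j0.
  by have [_ [j _ <-] BU] := refD _ DB; exists j.
have g0 B y : D B -> ~ B y -> g B y = 0.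
  by move=> DB nBy; have [_ _ /(_ y nBy) /nbhs_singleton] := gD _ DB.
pose w := locally_finite_sum D g.
have w_gt0 x : 0 < w x.
  have [B [DB Bx gB]] := gpos x; rewrite /w /locally_finite_sum.
  have fx := finite_containing x lfD.
  rewrite (big_fsetD1 B) /=; last by rewrite in_fset_set // inE.
  rewrite ltr_wpDr // big_seq sumr_ge0 // => A.
  rewrite in_fsetD1 => /andP[_]; rewrite in_fset_set // inE => -[DA _].
  by have [_ + _] := gD _ DA.
(* At a point of [U k] every summed [B] contains the point and lies in [U (i B)], so only meaningful
   values of the cocycle are averaged. *)
pose s k := locally_finite_sum D (fun B x => g B x * a (i B) k x).
exists (fun k x => s k x / w x); split=> [k x Ukx|j k x Ujx Ukx].
  apply: cvgM; last apply: cvgV.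
  - apply: locally_finite_sum_continuous => // [B DB|B y DB nBy]; last first.
      by rewrite g0 // mul0r.
    have [cg _ gnear] := gD _ DB; have [Bx|nBx] := pselect (B x).
      by apply: cvgM; [exact: cg|apply: ca => //; exact: iP].
    (* Off [B] nothing is known about [a (i B) k], but [g B] vanishes near the point. *)
    apply: cvg_near_cst.
    by apply: filterS (gnear _ nBx) => y ->; rewrite g0 // !mul0r.
  - by rewrite gt_eqF.
  - apply: locally_finite_sum_continuous => // B DB.
    by have [cg _ _] := gD _ DB; exact: cg.
(* Expand [a (i B) k] as [a (i B) j + a j k]; the last term is independent of [B], so its weights
   add up to [w x]. *)
have -> : s k x = s j x + w x * a j k x.
  rewrite /s /w /locally_finite_sum mulr_suml -big_split /= !big_seq.
  apply: eq_bigr => B; rewrite in_fset_set; last exact: finite_containing.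
  rewrite inE => -[DB Bx]; rewrite (aD (i B) j k) ?mulrDr //; exact: iP.
by rewrite mulrDl mulrAC divff ?mul1r // gt_eqF.
Qed.
End Paracompact.
(** * Tropical scalars and linear maps *)

Section TropicalTopology.
Variable R : realType.
Implicit Types a b c : trop R.

Lemma trop_cvg (T : Type) (F : set_system T) (f : T -> trop R) c :
  Filter F -> trop_val (f x) @[x --> F] --> trop_val c -> f @ F --> c.
Proof.
move=> FF fc A [B [[W oW WB] Bc] BA].
apply: (@filterS _ F _ (f @^-1` B)); first by move=> x /BA.
rewrite -WB; apply: (fc W); apply: open_nbhs_nbhs; split=> //.
by move: Bc; rewrite -WB.
Qed.

Lemma trop_val_continuous : continuous (@trop_val R).
Proof. exact: initial_continuous. Qed.

Lemma trop_neq0_near c : c != 0 -> \forall d \near c, d != 0.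
Proof.
move=> c0; have {}c0 : (-oo < trop_val c)%E.
  by rewrite ltNye; apply: contra c0 => /eqP c0; apply/eqP/val_inj.
apply: (@filterS _ (nbhs c) _ [set d | (-oo < trop_val d)%E]) => [d|].
  by rewrite /= ltNye; apply: contra => /eqP ->.
exact: (trop_val_continuous (open_ereal_gt' c0)).
Qed.

(** With +oo excluded, the sum of extended reals never meets an indeterminate form. *)
Lemma trop_mul_cvg (T : Type) (F : set_system T) (f g : T -> trop R) a b :
  Filter F -> f @ F --> a -> g @ F --> b -> f x * g x @[x --> F] --> a * b.
Proof.
move=> FF fa gb; apply: trop_cvg.
apply: (cvgeD (f := @trop_val R \o f) (g := @trop_val R \o g)).
- by case: a b {fa gb} => [[r| |] //= _] [[s| |] //= _].
- exact: cvg_comp fa (@trop_val_continuous a).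
- exact: cvg_comp gb (@trop_val_continuous b).
Qed.

Definition trop_of (r : R) : trop R := @Trop R r%:E isT.

Lemma trop_ofD r s : trop_of (r + s) = trop_of r * trop_of s.
Proof. exact: val_inj. Qed.

Lemma trop_of0 : trop_of 0 = 1.
Proof. exact: val_inj. Qed.

Lemma trop_of_cvg (T : Type) (F : set_system T) (f : T -> R) r :
  Filter F -> f @ F --> r -> trop_of (f x) @[x --> F] --> trop_of r.
Proof.
by move=> FF fr; apply: trop_cvg; apply: cvg_EFin => //; exact: nearW.
Qed.

(** The inverse of [trop_of] on nonzero scalars; the zero scalar gets the default value 0 of [fine],
    whence the conditions [a != 0] below. *)
Definition trop_fin a : R := fine (trop_val a).

Lemma trop_finK a : a != 0 -> trop_of (trop_fin a) = a.
Proof. by move=> a0; apply: val_inj; case: a a0 => [[r| |]]. Qed.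

Lemma trop_finM a b : a != 0 -> b != 0 ->
  trop_fin (a * b) = trop_fin a + trop_fin b.
Proof. by case: a b => [[r| |] ?] [[s| |] ?]. Qed.

Lemma trop_fin_cvg (T : Type) (F : set_system T) (f : T -> trop R) a :
  Filter F -> a != 0 -> f @ F --> a -> trop_fin (f x) @[x --> F] --> trop_fin a.
Proof.
move=> FF a0 fa; apply: fine_cvg.
have -> : (trop_fin a)%:E = trop_val a by rewrite -{2}(trop_finK a0).
exact: cvg_comp fa (@trop_val_continuous a).
Qed.

Lemma trop_mulf_eq0 a b : (a * b == 0) = (a == 0) || (b == 0).
Proof. by case: a b => [[r| |] ?] [[s| |] ?]. Qed.

Lemma trop_add_eq0 a b : a + b = 0 -> a = 0 /\ b = 0.
Proof.
move=> /(congr1 (@trop_val R)) /= ab0.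
have : (Order.max (trop_val a) (trop_val b) <= -oo)%E by rewrite ab0.
by rewrite ge_max !leeNy_eq => /andP[/eqP a0 /eqP b0]; split; exact: val_inj.
Qed.

Lemma trop_sum_eq0 (I : finType) (F : I -> trop R) :
  \sum_i F i = 0 -> forall i, F i = 0.
Proof. by move=> + i; rewrite (bigD1 i) //= => /trop_add_eq0[]. Qed.

Lemma trop_sum_neq0 (I : finType) (F : I -> trop R) :
  \sum_i F i != 0 -> exists i, F i != 0.
Proof.
move=> /eqP sF; apply: contrapT => nF; apply: sF; rewrite big1 // => i _.
by apply/eqP; apply: contrapT => /negP Fi; apply: nF; exists i.
Qed.

End TropicalTopology.

Lemma mx_cvg (T : topologicalType) (m n : nat) (S : Type) (F : set_system S)
    (f : S -> 'M[T]_(m, n)) (M : 'M[T]_(m, n)) :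
  Filter F -> (forall i j, f x i j @[x --> F] --> M i j) -> f @ F --> M.
Proof.
move=> FF fM A [P MP PA].
have : \forall x \near F, forall i j, P i j (f x i j).
  by apply: filter_forall => i; apply: filter_forall => j; exact: fM.
by apply: filterS => x Px; exact: PA.
Qed.

Lemma mx_coord_continuous (T : topologicalType) (m n : nat) i j :
  continuous (fun M : 'M[T]_(m, n) => M i j).
Proof.
move=> M A MA; exists (fun k l => [set y | k = i -> l = j -> A y]).
  move=> k l; have [[-> ->]|kl] := pselect (k = i /\ l = j).
    by apply: filterS MA => y Ay _ _.
  by apply: filterS filterT => y _ ki lj; case: kl.
by move=> N /(_ i j); apply.
Qed.

Lemma snd_coord_cvg (X T : topologicalType) m n (x : X) (v : 'M[T]_(m, n)) i j :
  (z : X * 'M[T]_(m, n)).2 i j @[z --> (x, v)] --> v i j.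
Proof.
apply: (@cvg_comp _ _ _ snd (fun M : 'M[T]_(m, n) => M i j) _ (nbhs v)).
  exact: cvg_snd.
exact: mx_coord_continuous.
Qed.

Lemma fst_comp_cvg (X Y T : topologicalType) (f : X -> T) x (y : Y) :
  {for x, continuous f} -> f z.1 @[z --> (x, y)] --> f x.
Proof.
move=> cf; apply: (@cvg_comp _ _ _ fst f _ (nbhs x)); last exact: cf.
exact: cvg_fst.
Qed.

(** * Linear automorphisms of T^n and their permutations *)

Section TropicalLinear.
Variables (R : realType) (n : nat).
Implicit Types f g : 'cV[trop R]_n -> 'cV[trop R]_n.

Definition trop_iso f : Prop :=
  trop_linear f /\ exists g, [/\ trop_linear g, cancel f g & cancel g f].

(** At [f := transition phi psi x] this is convertible to the permutation of
    [transition_mx phi psi x] used in [associated]. *)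
Definition support_perm f : 'S_n :=
  gl_perm (\matrix_(i, j) f (delta_mx j 0) i 0).

Lemma trop_linear_comp f g :
  trop_linear f -> trop_linear g -> trop_linear (g \o f).
Proof.
move=> [fZ fD] [gZ gD]; split=> [a u|u v] /=; first by rewrite fZ gZ.
by rewrite fD gD.
Qed.

Lemma trop_linear_inv f g :
  trop_linear f -> cancel f g -> cancel g f -> trop_linear g.
Proof.
move=> [fZ fD] fK gK; split=> [a u|u v]; apply: (can_inj fK).
  by rewrite fZ !gK.
by rewrite fD !gK.
Qed.

Lemma trop_iso_id : trop_iso id.
Proof. by split=> //; exists id. Qed.

Lemma trop_iso_comp f g : trop_iso f -> trop_iso g -> trop_iso (g \o f).
Proof.
move=> [lf [f' [lf' fK f'K]]] [lg [g' [lg' gK g'K]]].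
split; first exact: trop_linear_comp.
by exists (f' \o g'); split; [exact: trop_linear_comp|exact: can_comp..].
Qed.

Lemma trop_linearE f v i : trop_linear f ->
  f v i 0 = \sum_j f (delta_mx j 0) i 0 * v j 0.
Proof.
move=> [fZ fD].
have f0 : f 0 = 0.
  by rewrite -[X in f X](scale0r (0 : 'cV[trop R]_n)) fZ scale0r.
have -> : v = \sum_j v j 0 *: delta_mx j 0.
  apply/matrixP => k l; rewrite ord1 summxE (bigD1 k) //= big1 ?addr0.
    by rewrite !mxE !eqxx mulr1.
  by move=> j jk; rewrite !mxE eq_sym (negPf jk) mulr0.
rewrite (big_morph f fD f0) summxE; apply: eq_bigr => j _.
rewrite fZ mxE mulrC; congr (_ * _).
rewrite summxE (bigD1 j) //= big1 ?addr0; first by rewrite !mxE !eqxx mulr1.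
by move=> k kj; rewrite !mxE eq_sym (negPf kj) mulr0.
Qed.

(** Let [a], [b] be the mutually inverse matrices. The k-th diagonal entry of [b a] is 1, so some
    [l = s k] has [a l k] and [b k l] both nonzero. A second nonzero entry in column [k] of [a]
    would make an off-diagonal entry of [a b] nonzero, and [s k = s l] with [k != l] would do so for
    [b a]. *)
Lemma trop_iso_delta f i j : trop_iso f ->
  (f (delta_mx i 0) j 0 != 0) = (j == support_perm f i).
Proof.
move=> [lf [g [lg fK gK]]].
pose a k l := f (delta_mx l 0) k 0; pose b k l := g (delta_mx l 0) k 0.
have baE k l : \sum_m b k m * a m l = (k == l)%:R.
  rewrite -[LHS](trop_linearE (f (delta_mx l 0)) k lg) fK mxE.
  by rewrite eqxx andbT.
have abE k l : \sum_m a k m * b m l = (k == l)%:R.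
  rewrite -[LHS](trop_linearE (g (delta_mx l 0)) k lf) gK mxE.
  by rewrite eqxx andbT.
have colP k : exists l, a l k != 0 /\ b k l != 0.
  have : \sum_m b k m * a m k != 0 by rewrite baE eqxx oner_neq0.
  case/trop_sum_neq0 => m; rewrite trop_mulf_eq0 negb_or => /andP[bkm amk].
  by exists m.
have [s sP] := choice colP.
have a_uniq k l : a l k != 0 -> l = s k.
  move=> alk; apply/eqP; apply: contrapT => /negP ls.
  have := abE l (s k); rewrite (negPf ls) => /trop_sum_eq0 /(_ k)/eqP.
  by rewrite trop_mulf_eq0 (negPf alk) (negPf (sP k).2).
have s_inj : injective s.
  move=> k l skl; apply/eqP; apply: contrapT => /negP kl.
  have := baE k l; rewrite (negPf kl) => /trop_sum_eq0 /(_ (s k))/eqP.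
  by rewrite trop_mulf_eq0 (negPf (sP k).2) skl (negPf (sP l).1).
suff pE : support_perm f = perm s_inj.
  rewrite pE permE; apply/idP/eqP => [/a_uniq //|->]; exact: (sP i).1.
rewrite /support_perm /gl_perm.
case: pickP => [t /forallP tP|/(_ (perm s_inj))] /=.
  apply/permP => k; rewrite permE; apply: a_uniq.
  by have := tP k; rewrite mxE.
by move=> /negP[]; apply/forallP => k; rewrite mxE permE; exact: (sP k).1.
Qed.

Lemma trop_isoE f v i : trop_iso f ->
  f v (support_perm f i) 0 =
  f (delta_mx i 0) (support_perm f i) 0 * v i 0.
Proof.
move=> isof; rewrite (trop_linearE _ _ isof.1) (bigD1 i) //=.
rewrite big1 ?addr0 // => j ji.
have : ~~ (f (delta_mx j 0) (support_perm f i) 0 != 0).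
  by rewrite trop_iso_delta // (inj_eq perm_inj) eq_sym.
by rewrite negbK => /eqP ->; rewrite mul0r.
Qed.

Lemma support_perm_neq0 f i : trop_iso f ->
  f (delta_mx i 0) (support_perm f i) 0 != 0.
Proof. by move=> isof; rewrite trop_iso_delta. Qed.

Lemma support_perm_id i : support_perm id i = i.
Proof.
apply/esym/eqP; rewrite -(trop_iso_delta i i trop_iso_id) mxE !eqxx.
exact: oner_neq0.
Qed.

Lemma support_perm_comp f g i : trop_iso f -> trop_iso g ->
  support_perm (g \o f) i = support_perm g (support_perm f i).
Proof.
move=> isof isog; apply/esym/eqP.
rewrite -trop_iso_delta; last exact: trop_iso_comp.
by rewrite /= trop_isoE // trop_mulf_eq0 negb_or !support_perm_neq0.
Qed.

(** The nonzero entries of [F x] stay nonzero nearby, and one nonzero entry per column already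
    determines the permutation. *)
Lemma support_perm_near (X : topologicalType)
    (F : X -> 'cV[trop R]_n -> 'cV[trop R]_n) (x : X) :
  (\forall y \near x, trop_iso (F y)) ->
  (forall v, {for x, continuous (F^~ v)}) ->
  \forall y \near x, support_perm (F y) = support_perm (F x).
Proof.
move=> isoF cF; have isox := nbhs_singleton isoF.
have : \forall y \near x, forall i,
    F y (delta_mx i 0) (support_perm (F x) i) 0 != 0.
  apply: filter_forall => i.
  have /trop_neq0_near := support_perm_neq0 i isox.
  by move=> /mx_coord_continuous /cF.
apply: filterS2 isoF => y isoy ny; apply/permP => i.
by apply/esym/eqP; rewrite -trop_iso_delta.
Qed.

End TropicalLinear.
(** * Gluing along local trivializations *)

Section LocalTriv.
Variables (X E F : topologicalType) (p : E -> X) (cp : continuous p).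
Implicit Types phi psi : local_triv F p.

Lemma near_dom phi e : dom phi (p e) -> \forall e' \near e, dom phi (p e').
Proof.
by move=> pe; apply: cp; apply: open_nbhs_nbhs; split=> //; exact: dom_open.
Qed.

Lemma to_prod_continuous_at phi e :
  dom phi (p e) -> {for e, continuous (to_prod phi)}.
Proof.
move=> pe; have := to_prod_continuous (l := phi).
rewrite continuous_open_subspace; first by apply; rewrite inE.
by apply: open_comp; [move=> ? _; exact: cp|exact: dom_open].
Qed.

Lemma of_prod_continuous_at phi z :
  dom phi z.1 -> {for z, continuous (of_prod phi)}.
Proof.
move=> zd; have := of_prod_continuous (l := phi).
rewrite continuous_open_subspace; first by apply; rewrite inE.
have -> : dom phi `*` setT = fst @^-1` dom phi :> set (X * F).
  by apply/seteqP; split=> [y []|y].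
by apply: open_comp; [move=> ? _; exact: cvg_fst|exact: dom_open].
Qed.

Lemma to_prodE phi e :
  dom phi (p e) -> to_prod phi e = (p e, (to_prod phi e).2).
Proof. by move=> pe; rewrite -(to_prod_over pe); case: to_prod. Qed.

Lemma of_prod_fibre phi e :
  dom phi (p e) -> of_prod phi (p e, (to_prod phi e).2) = e.
Proof. by move=> pe; rewrite -to_prodE // to_prodK. Qed.

Lemma transition_id phi x v : dom phi x -> transition phi phi x v = v.
Proof. by move=> xd; rewrite /transition /fibre_map of_prodK. Qed.

End LocalTriv.

Lemma fibre_map_comp (X E E' E'' F : topologicalType) (p : E -> X)
    (p' : E' -> X) (p'' : E'' -> X) (phi : local_triv F p)
    (psi : local_triv F p') (chi : local_triv F p'')
    (f : E -> E') (g : E' -> E'') x v :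
  (forall e, p' (f e) = p e) -> dom phi x -> dom psi x ->
  fibre_map phi chi (g \o f) x v =
  fibre_map psi chi g x (fibre_map phi psi f x v).
Proof.
move=> pf xphi xpsi; have pe : p' (f (of_prod phi (x, v))) = x.
  by rewrite pf of_prod_over.
by rewrite /fibre_map /= -[X in of_prod psi (X, _)]pe of_prod_fibre ?pe.
Qed.

Lemma fibre_map_continuous (X E E' F : topologicalType) (p : E -> X)
    (p' : E' -> X) (phi : local_triv F p) (psi : local_triv F p')
    (f : E -> E') x v :
  continuous p' -> continuous f -> (forall e, p' (f e) = p e) ->
  dom phi x -> dom psi x ->
  {for (x, v), continuous (fun z => fibre_map phi psi f z.1 z.2)}.
Proof.
move=> cp' cf pf xphi xpsi.
apply: (@continuous_comp _ _ _
  (fun z => to_prod psi (f (of_prod phi (z.1, z.2)))) snd); last exact: cvg_snd.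
have -> : (fun z => to_prod psi (f (of_prod phi (z.1, z.2)))) =
    to_prod psi \o (f \o of_prod phi) by apply/funext => -[].
apply: continuous_comp; last first.
  by apply: to_prod_continuous_at => //=; rewrite pf of_prod_over.
by apply: continuous_comp; [exact: of_prod_continuous_at|exact: cf].
Qed.

(** * Gluing maps and spaces from local data *)

Section GlueMaps.
Variables (X E E' F F' : topologicalType) (p : E -> X) (p' : E' -> X).
Variables (cp : continuous p) (J : Type).
Variables (Phi : J -> local_triv F p) (Psi : J -> local_triv F' p').
Variable h : J -> X -> F -> F'.
Let U j := dom (Phi j) `&` dom (Psi j).

(** A chart is chosen at each point with no continuity in the choice; compatibility makes every
    other chart give the same value, so near a point one fixed chart formula describes [f]. *)
Lemma glue_maps :
  (forall x, exists j, U j x) ->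
  (forall j x v, U j x -> {for (x, v), continuous (fun z => h j z.1 z.2)}) ->
  (forall j k x v, U j x -> U k x ->
     h k x (transition (Phi j) (Phi k) x v) =
     transition (Psi j) (Psi k) x (h j x v)) ->
  exists f : E -> E',
    [/\ continuous f, forall e, p' (f e) = p e &
        forall j e, U j (p e) ->
          f e = of_prod (Psi j) (p e, h j (p e) (to_prod (Phi j) e).2)].
Proof.
move=> /choice[j jU] hc hcompat.
pose f e := let i := j (p e) in
  of_prod (Psi i) (p e, h i (p e) (to_prod (Phi i) e).2).
have fE i e : U i (p e) ->
    f e = of_prod (Psi i) (p e, h i (p e) (to_prod (Phi i) e).2).
  move=> [iPhi iPsi]; have [jPhi jPsi] := jU (p e).
  rewrite /f /=; set x := p e.
  have -> : (to_prod (Phi (j x)) e).2 =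
      transition (Phi i) (Phi (j x)) x (to_prod (Phi i) e).2.
    by rewrite /transition /fibre_map of_prod_fibre.
  rewrite hcompat //.
  set w := h i x _; rewrite /transition /fibre_map.
  have pw : p' (of_prod (Psi i) (x, w)) = x by rewrite of_prod_over.
  by rewrite -[X in (X, _)]pw of_prod_fibre // pw.
exists f; split=> //; last first.
  by move=> e; rewrite /f of_prod_over //; case: (jU (p e)).
move=> e; pose i := j (p e); have [iPhi iPsi] := jU (p e).
suff : f y @[y --> e] -->
    of_prod (Psi i) (p e, h i (p e) (to_prod (Phi i) e).2) by rewrite -fE.
apply: (cvg_trans
  (G := of_prod (Psi i) (p y, h i (p y) (to_prod (Phi i) y).2) @[y --> e])).
  apply: near_eq_cvg.
  have := near_dom cp iPhi.
  have : \forall y \near e, dom (Psi i) (p y).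
    by apply: cp; apply: open_nbhs_nbhs; split=> //; exact: dom_open.
  by apply: filterS2 => y yPsi yPhi; rewrite (fE i).
pose q y := (p y, h i (p y) (to_prod (Phi i) y).2).
apply: (@continuous_comp _ _ _ q (of_prod (Psi i)));
  last exact: of_prod_continuous_at.
apply: cvg_pair; first exact: cp.
have -> : (fun y => h i (p y) (to_prod (Phi i) y).2) =
   (fun z => h i z.1 z.2) \o (fun y => (p y, (to_prod (Phi i) y).2)) by [].
apply: continuous_comp; last exact: hc.
apply: cvg_pair; first exact: cp.
apply: (@continuous_comp _ _ _ (to_prod (Phi i)) snd); last exact: cvg_snd.
exact: to_prod_continuous_at.
Qed.

End GlueMaps.

Lemma glue_homeos (X E E' F F' : topologicalType) (p : E -> X) (p' : E' -> X)
    (J : Type) (Phi : J -> local_triv F p) (Psi : J -> local_triv F' p')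
    (h : J -> X -> F -> F') (h' : J -> X -> F' -> F) :
  let U j := dom (Phi j) `&` dom (Psi j) in
  continuous p -> continuous p' ->
  (forall x, exists j, U j x) ->
  (forall j x v, U j x -> {for (x, v), continuous (fun z => h j z.1 z.2)}) ->
  (forall j x v, U j x -> {for (x, v), continuous (fun z => h' j z.1 z.2)}) ->
  (forall j x, U j x -> cancel (h j x) (h' j x)) ->
  (forall j x, U j x -> cancel (h' j x) (h j x)) ->
  (forall j k x v, U j x -> U k x ->
     h k x (transition (Phi j) (Phi k) x v) =
     transition (Psi j) (Psi k) x (h j x v)) ->
  exists2 f : E -> E', homeo_over p p' f &
    forall j e, U j (p e) ->
      f e = of_prod (Psi j) (p e, h j (p e) (to_prod (Phi j) e).2).
Proof.
move=> U cp cp' covU hc hc' hK h'K hcompat.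
have [f [cf pf fE]] := glue_maps cp covU hc hcompat.
have covU' x : exists j, (dom (Psi j) `&` dom (Phi j)) x.
  by have [j] := covU x; rewrite /U setIC; exists j.
have [|||g [cg pg gE]] := @glue_maps X E' E F' F p' p cp' J Psi Phi h'.
- by [].
- by move=> j x v; rewrite setIC; exact: hc'.
(* The compatibility of [h'] is that of [h], conjugated by the inverses. *)
- move=> j k x v [jPsi jPhi] [kPsi kPhi]; have [jx kx] : U j x /\ U k x by [].
  by apply: (can_inj (hK _ _ kx)); rewrite h'K // hcompat // h'K.
exists f; last exact: fE.
split=> //; exists g; split=> // e.
  have [j [jPhi jPsi]] := covU (p e).
  rewrite (gE j) ?pf // (fE j) // of_prodK //= hK // of_prod_fibre //.
have [j [jPhi jPsi]] := covU (p' e).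
by rewrite (fE j) ?pg // (gE j) // of_prodK //= h'K // of_prod_fibre.
Qed.

Lemma near_fst (X F : topologicalType) (A : set X) (z : X * F) :
  open A -> A z.1 ->
  \forall z' \near z, A z'.1.
Proof.
move=> oA Az; apply: (@cvg_fst _ _ (nbhs z.1) (nbhs z.2)).
exact: open_nbhs_nbhs.
Qed.

(* The point (x, v) of the glued space is the one over x whose coordinate in
   the chart c x is v; g i j x changes coordinates from chart i to chart j. *)
Definition glued (I : Type) (X F : topologicalType) (g : I -> I -> X -> F -> F)
  (U : I -> set X) (c : X -> I) : Type := (X * F)%type.

Section Glued.
Variables (I : Type) (X F : topologicalType) (g : I -> I -> X -> F -> F).
Variables (U : I -> set X) (c : X -> I).
Local Notation E := (glued g U c).

HB.instance Definition _ := Choice.on E.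

(** The final topology for the chart parametrizations, written with neighbourhoods. The product
    topology of [X * F] would be wrong, since the reference chart [c x] may jump with [x]; only the
    choice structure is inherited. *)
Definition glued_open : set_system E := [set W | forall i (z : X * F),
  U i z.1 -> W (z.1, g i (c z.1) z.1 z.2) ->
  \forall z' \near z, W (z'.1, g i (c z'.1) z'.1 z'.2)].

Fact glued_openT : glued_open setT.
Proof. by move=> i z _ _; exact: filterT. Qed.

Fact glued_openI : setI_closed glued_open.
Proof.
by move=> V W oV oW i z iz [Vz Wz]; apply: filterI; [exact: oV|exact: oW].
Qed.

Fact glued_open_bigcup (K : Type) (f : K -> set E) :
  (forall k, glued_open (f k)) -> glued_open (\bigcup_k f k).
Proof.
move=> of_ i z iz [k _ fk]; apply: filterS (of_ k i z iz fk) => z' fz'.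
by exists k.
Qed.

HB.instance Definition _ :=
  isOpenTopological.Build E glued_openT glued_openI glued_open_bigcup.

Lemma glued_openP (W : set E) : open W <-> glued_open W.
Proof. by []. Qed.

Definition glued_proj (e : E) : X := e.1.

Hypothesis oU : forall i, open (U i).
Hypothesis cU : forall x, U (c x) x.
Hypothesis g_id : forall i x v, U i x -> g i i x v = v.
Hypothesis gD : forall i j k x v, U i x -> U j x -> U k x ->
  g j k x (g i j x v) = g i k x v.
Hypothesis cg : forall i j x v, U i x -> U j x ->
  {for (x, v), continuous (fun z => g i j z.1 z.2)}.

Definition glued_to_prod i (e : E) : X * F := (e.1, g (c e.1) i e.1 e.2).
Definition glued_of_prod i (z : X * F) : E := (z.1, g i (c z.1) z.1 z.2).

Lemma glued_proj_continuous : continuous glued_proj.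
Proof.
apply/continuousP => A oA; apply/glued_openP => i z iz Az.
apply: (@cvg_fst _ _ (nbhs z.1) (nbhs z.2)).
exact: open_nbhs_nbhs.
Qed.

Lemma glued_to_of_prod i j z : U i z.1 -> U j z.1 ->
  glued_to_prod j (glued_of_prod i z) = (z.1, g i j z.1 z.2).
Proof. by move=> iz jz; rewrite /glued_to_prod /= gD. Qed.

Lemma glued_of_prod_continuous i z :
  U i z.1 -> {for z, continuous (glued_of_prod i)}.
Proof.
move=> iz A; rewrite /= nbhsE => -[W [oW Wz] WA].
by have := iffLR (glued_openP W) oW i z iz Wz; apply: filterS => z' /WA.
Qed.

Lemma glued_to_prod_continuous i (e : E) :
  U i (glued_proj e) -> {for e, continuous (glued_to_prod i)}.
Proof.
move=> ie A; rewrite /= nbhsE => -[W [oW We] WA].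
(* Seen from a chart [j], this set is the preimage of [W] under the change of coordinates [g j i],
   which is continuous. *)
suff oV : open ([set e' : E | U i e'.1 /\ W (glued_to_prod i e')]).
  have : nbhs e [set e' : E | U i e'.1 /\ W (glued_to_prod i e')].
    exact: open_nbhs_nbhs.
  by apply: filterS => e' [_ /WA].
apply/glued_openP => j z jz [/= iz +].
rewrite -/(glued_of_prod j z) glued_to_of_prod // => Wz.
have Wn : \forall z' \near z, W (z'.1, g j i z'.1 z'.2).
  have : (fun z' => (z'.1, g j i z'.1 z'.2)) z' @[z' --> z] -->
      (z.1, g j i z.1 z.2).
    apply: cvg_pair; first exact: cvg_fst.
    by case: z jz iz {Wz} => x v jz iz; exact: cg.
  by apply; exact: open_nbhs_nbhs.
apply: filterS3 (near_fst (oU i) iz) (near_fst (oU j) jz) Wn => z' iz' jz' Wz'.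
by split=> //; rewrite -/(glued_of_prod j z') glued_to_of_prod.
Qed.

Definition glued_chart (i : I) : local_triv F glued_proj.
Proof.
apply: (@LocalTriv X E F glued_proj (U i)
  (glued_to_prod i) (glued_of_prod i)) => //.
- rewrite continuous_open_subspace; last first.
    by apply: open_comp => // e _; exact: glued_proj_continuous.
  by move=> e; rewrite inE; exact: glued_to_prod_continuous.
- have -> : U i `*` setT = fst @^-1` U i :> set (X * F).
    by apply/seteqP; split=> [y []|y].
  rewrite continuous_open_subspace; last first.
    by apply: open_comp => // e _; exact: cvg_fst.
  by move=> z; rewrite inE; exact: glued_of_prod_continuous.
- by case=> x v ix; rewrite /glued_of_prod /= gD // g_id.
- by case=> x v ix; rewrite glued_to_of_prod // g_id.
Defined.

Lemma glued_transition i j x v : U i x -> U j x ->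
  transition (glued_chart i) (glued_chart j) x v = g i j x v.
Proof.
by move=> ix jx; rewrite /transition /fibre_map /= gD.
Qed.

End Glued.

(** Used with permutations of a discrete fibre to build the associated covering, and with
    reindexings of T^n to build a bundle from a covering. *)
Lemma glue_spaces (I : Type) (X F : topologicalType) (U : I -> set X)
    (g : I -> I -> X -> F -> F) :
  (forall i, open (U i)) -> (forall x, exists i, U i x) ->
  (forall i x v, U i x -> g i i x v = v) ->
  (forall i j k x v, U i x -> U j x -> U k x ->
     g j k x (g i j x v) = g i k x v) ->
  (forall i j x v, U i x -> U j x ->
     {for (x, v), continuous (fun z => g i j z.1 z.2)}) ->
  exists (E : topologicalType) (p : E -> X) (chart : I -> local_triv F p),
    [/\ continuous p, forall i, dom (chart i) = U i &
        forall i j x v, U i x -> U j x ->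
          transition (chart i) (chart j) x v = g i j x v].
Proof.
move=> oU /choice[c cU] g_id gD cg.
exists (glued g U c), (@glued_proj I X F g U c), (glued_chart oU cU g_id gD cg).
split=> //; first exact: glued_proj_continuous.
by move=> i j x v; exact: glued_transition.
Qed.

(** * Discrete fibres and homeomorphisms over the base *)

Lemma pair_cst_continuous (X F : topologicalType) (v : F) :
  continuous (fun x : X => (x, v)).
Proof.
move=> x; apply: (@cvg_pair _ _ _ (nbhs x) (nbhs x) (nbhs v)).
  exact: cvg_id.
exact: cvg_cst.
Qed.

Lemma discrete_prod_continuous (X T : topologicalType) (I : choiceType)
    (h : X -> I -> T) x (i : discrete_topology I) :
  (\forall y \near x, h y = h x) ->
  {for (x, i), continuous (fun z : X * discrete_topology I => h z.1 z.2)}.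
Proof.
move=> hx; apply: cvg_near_cst.
exists ([set y | h y = h x], [set i]) => /=; last first.
  by case=> y k [/= -> ->].
by split=> //; rewrite nbhs_principalE; exact/principal_filterP.
Qed.

Lemma near_discrete_cst (X : topologicalType) (I : choiceType)
    (f : X -> discrete_topology I) x :
  {for x, continuous f} -> \forall y \near x, f y = f x.
Proof.
move=> cf; apply: (cf [set f x]).
by rewrite nbhs_principalE; exact/principal_filterP.
Qed.

(** For each of the finitely many points of the fibre the value is locally constant in [y]; the
    finitely many neighbourhoods are intersected. *)
Lemma near_fibre_map_discrete (X E E' : topologicalType) n (p : E -> X)
    (p' : E' -> X) (phi : local_triv (discrete_topology 'I_n) p)
    (psi : local_triv (discrete_topology 'I_n) p') (f : E -> E') x :
  continuous p' -> continuous f -> (forall e, p' (f e) = p e) ->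
  dom phi x -> dom psi x ->
  \forall y \near x, fibre_map phi psi f y = fibre_map phi psi f x.
Proof.
move=> cp' cf pf xphi xpsi.
have : \forall y \near x, forall i,
    fibre_map phi psi f y i = fibre_map phi psi f x i.
  apply: filter_forall => i.
  apply: near_discrete_cst; apply: (@continuous_comp _ _ _
    (fun y : X => (y, i : discrete_topology 'I_n))
    (fun z => fibre_map phi psi f z.1 z.2)).
    exact: pair_cst_continuous.
  exact: fibre_map_continuous.
by apply: filterS => y yi; apply/funext.
Qed.

Lemma fibre_map_cancel (X E E' F : topologicalType) (p : E -> X)
    (p' : E' -> X) (phi : local_triv F p) (psi : local_triv F p')
    (f : E -> E') (g : E' -> E) x :
  (forall e, p' (f e) = p e) -> cancel f g -> dom phi x -> dom psi x ->
  cancel (fibre_map phi psi f x) (fibre_map psi phi g x).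
Proof.
move=> pf fK xphi xpsi v; rewrite -(@fibre_map_comp _ _ _ _ _ _ _ _ phi) //.
by rewrite /fibre_map /= fK of_prodK.
Qed.

Lemma homeo_over_id (X E : topologicalType) (p : E -> X) : homeo_over p p id.
Proof.
have cid : continuous (@id E) by move=> e.
by split=> //; exists id.
Qed.

Lemma homeo_over_sym (X E E' : topologicalType) (p : E -> X) (p' : E' -> X) f :
  homeo_over p p' f ->
  exists g, [/\ homeo_over p' p g, cancel f g & cancel g f].
Proof.
move=> [cf [g [cg fK gK]] pf]; exists g; split=> //; split=> //.
  by exists f.
by move=> e; rewrite -pf gK.
Qed.

Lemma homeo_over_comp (X E E' E'' : topologicalType) (p : E -> X)
    (p' : E' -> X) (p'' : E'' -> X) f g :
  homeo_over p p' f -> homeo_over p' p'' g -> homeo_over p p'' (g \o f).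
Proof.
move=> [cf [f' [cf' fK f'K]] pf] [cg [g' [cg' gK g'K]] pg]; split.
- by move=> e; apply: continuous_comp; [exact: cf|exact: cg].
- exists (f' \o g'); split; [|exact: can_comp|exact: can_comp].
  by move=> e; apply: continuous_comp; [exact: cg'|exact: cf'].
- by move=> e; rewrite /= pg pf.
Qed.

(** * Bundles and their associated coverings *)

Section BundleIsos.
Variables (R : realType) (X : topologicalType) (n : nat).
Implicit Types E : tbundle R X n.

(** [tb_iso] hides its map; the permutations of the fibre maps depend on that map, so it is made
    explicit. *)
Definition tb_homeo E E' (f : tb_total E -> tb_total E') : Prop :=
  homeo_over (@tb_proj _ _ _ E) (@tb_proj _ _ _ E') f /\
  forall phi psi, tb_atlas phi -> tb_atlas psi ->
    forall x, dom phi x -> dom psi x -> trop_linear (fibre_map phi psi f x).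

Lemma tb_isoP E E' : tb_iso E E' <-> exists f, @tb_homeo E E' f.
Proof. by split=> [[f ? ?]|[f [? ?]]]; exists f. Qed.

(** Transition functions are the fibre maps of [id], so through this lemma the results on [tb_homeo]
    apply to them as well. *)
Lemma tb_homeo_id E : @tb_homeo E E id.
Proof. by split; [exact: homeo_over_id|exact: tb_atlas_linear]. Qed.

Lemma tb_homeo_sym E E' f : @tb_homeo E E' f ->
  exists g, [/\ @tb_homeo E' E g, cancel f g & cancel g f].
Proof.
move=> [hf lf]; have [g [hg fK gK]] := homeo_over_sym hf.
exists g; split=> //; split=> // phi psi aphi apsi x xphi xpsi.
have [_ _ pf] := hf; have [_ _ pg] := hg.
apply: (trop_linear_inv (lf psi phi apsi aphi x xpsi xphi)).
  exact: fibre_map_cancel.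
exact: fibre_map_cancel.
Qed.

Lemma tb_homeo_comp E E' E'' f g :
  @tb_homeo E E' f -> @tb_homeo E' E'' g -> @tb_homeo E E'' (g \o f).
Proof.
move=> [hf lf] [hg lg]; split; first exact: homeo_over_comp hf hg.
move=> phi chi aphi achi x xphi xchi; have [_ _ pf] := hf.
have [psi apsi xpsi] := @tb_atlas_cover _ _ _ E' x.
have -> : fibre_map phi chi (g \o f) x =
    fibre_map psi chi g x \o fibre_map phi psi f x.
  by apply/funext => v; exact: fibre_map_comp.
by apply: trop_linear_comp; [exact: lf|exact: lg].
Qed.

Lemma tb_iso_refl E : tb_iso E E.
Proof. by apply/tb_isoP; exists id; exact: tb_homeo_id. Qed.

Lemma tb_iso_sym E E' : tb_iso E E' -> tb_iso E' E.
Proof.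
by move=> /tb_isoP[f /tb_homeo_sym[g [hg _ _]]]; apply/tb_isoP; exists g.
Qed.

Lemma tb_iso_trans E E' E'' : tb_iso E E' -> tb_iso E' E'' -> tb_iso E E''.
Proof.
move=> /tb_isoP[f hf] /tb_isoP[g hg]; apply/tb_isoP; exists (g \o f).
exact: tb_homeo_comp hf hg.
Qed.

Section FibreMaps.
Variables (E E' : tbundle R X n) (f : tb_total E -> tb_total E').
Hypothesis hf : @tb_homeo E E' f.
Variables (phi : local_triv 'cV[trop R]_n (@tb_proj _ _ _ E)).
Variables (psi : local_triv 'cV[trop R]_n (@tb_proj _ _ _ E')).
Hypotheses (aphi : tb_atlas phi) (apsi : tb_atlas psi).

Lemma fibre_map_iso x :
  dom phi x -> dom psi x -> trop_iso (fibre_map phi psi f x).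
Proof.
move=> xphi xpsi; have [hg lf] := hf; split; first exact: lf.
have [g [[[_ _ pg] lg] fK gK]] := tb_homeo_sym hf.
exists (fibre_map psi phi g x); split; first exact: lg.
  by apply: fibre_map_cancel => //; have [] := hg.
exact: fibre_map_cancel.
Qed.

Lemma near_support_perm_fibre_map x : dom phi x -> dom psi x ->
  \forall y \near x, support_perm (fibre_map phi psi f y) =
                     support_perm (fibre_map phi psi f x).
Proof.
move=> xphi xpsi; have [[cf _ pf] _] := hf.
apply: support_perm_near => [|v].
  have xphi' := open_nbhs_nbhs (conj (@dom_open _ _ _ _ phi) xphi).
  have xpsi' := open_nbhs_nbhs (conj (@dom_open _ _ _ _ psi) xpsi).
  by apply: filterS2 xphi' xpsi' => y; exact: fibre_map_iso.
apply: (@continuous_comp _ _ _ (fun y : X => (y, v))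
  (fun z => fibre_map phi psi f z.1 z.2)).
  exact: pair_cst_continuous.
by apply: fibre_map_continuous => //; exact: tb_proj_continuous.
Qed.

End FibreMaps.

Lemma support_perm_fibre_map_comp E E' E'' f g phi psi chi x i :
  @tb_homeo E E' f -> @tb_homeo E' E'' g ->
  tb_atlas phi -> tb_atlas psi -> tb_atlas chi ->
  dom phi x -> dom psi x -> dom chi x ->
  support_perm (fibre_map phi chi (g \o f) x) i =
  support_perm (fibre_map psi chi g x) (support_perm (fibre_map phi psi f x) i).
Proof.
move=> hf hg aphi apsi achi xphi xpsi xchi; have [[_ _ pf] _] := hf.
rewrite -support_perm_comp; [|exact: fibre_map_iso..].
congr (support_perm _ _); apply/funext => v; exact: fibre_map_comp.
Qed.

End BundleIsos.

(** * Existence and uniqueness of the associated covering, and the section *)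

Section Associated.
Variables (R : realType) (X : topologicalType) (n : nat).
Implicit Types (E : tbundle R X n) (Y : covering X n).

Lemma support_perm_transition_comp E phi psi chi x i :
  @tb_atlas _ _ _ E phi -> tb_atlas psi -> tb_atlas chi ->
  dom phi x -> dom psi x -> dom chi x ->
  support_perm (transition phi chi x) i =
  support_perm (transition psi chi x) (support_perm (transition phi psi x) i).
Proof.
exact: (support_perm_fibre_map_comp i (tb_homeo_id E) (tb_homeo_id E)).
Qed.

Lemma associated_exists E : exists Y, associated E Y.
Proof.
pose I := local_triv 'cV[trop R]_n (@tb_proj _ _ _ E).
(* [associated] wants a chart for every local trivialization; those outside the atlas get an empty
   domain and impose no condition. *)
pose U (phi : I) : set X := [set x | tb_atlas phi /\ dom phi x].
pose g (phi psi : I) x (i : discrete_topology 'I_n) : discrete_topology 'I_n :=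
  support_perm (transition phi psi x) i.
have [||||| Y [p [chart [cp domE chartE]]]] :=
  @glue_spaces I X (discrete_topology 'I_n) U g.
- move=> phi; have [aphi|naphi] := pselect (tb_atlas phi).
    rewrite (_ : U phi = dom phi); first exact: dom_open.
    by apply/seteqP; split=> [x []|x].
  rewrite (_ : U phi = set0); first exact: open0.
  by apply/seteqP; split=> [x []|x].
- by move=> x; have [phi aphi xphi] := @tb_atlas_cover _ _ _ E x; exists phi.
- move=> phi x i [aphi xphi]; rewrite /g -[RHS](@support_perm_id R n).
  congr (support_perm _ _); apply/funext => v; exact: transition_id.
- move=> phi psi chi x i [aphi xphi] [apsi xpsi] [achi xchi].
  by rewrite /g -support_perm_transition_comp.
- move=> phi psi x i [aphi xphi] [apsi xpsi]; apply: discrete_prod_continuous.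
  have := near_support_perm_fibre_map (tb_homeo_id E) aphi apsi xphi xpsi.
  by apply: filterS => y gy; apply/funext => j; congr (fun_of_perm _ _).
have cov x : exists phi : local_triv (discrete_topology 'I_n) p, dom phi x.
  have [phi aphi xphi] := @tb_atlas_cover _ _ _ E x.
  by exists (chart phi); rewrite domE.
exists (Covering cp cov), chart.
split=> [phi aphi|phi psi aphi apsi x xphi xpsi i].
  by rewrite domE; apply/seteqP; split=> [x []|x].
exact: chartE.
Qed.

Lemma associated_unique E E' Y Y' :
  tb_iso E E' -> associated E Y -> associated E' Y' -> cov_iso Y Y'.
Proof.
move=> /tb_isoP[f hf] [t [domt transt]] [t' [domt' transt']].
have [f' [hf' fK f'K]] := tb_homeo_sym hf.
(* Indexing by pairs of atlas charts allows the isomorphism to be glued from the permutations of the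
   fibre maps of [f]. *)
pose J := {q : local_triv 'cV[trop R]_n (@tb_proj _ _ _ E) *
               local_triv 'cV[trop R]_n (@tb_proj _ _ _ E') |
           tb_atlas q.1 /\ tb_atlas q.2}.
pose phi (j : J) := (projT1 j).1; pose psi (j : J) := (projT1 j).2.
have aphi j : tb_atlas (phi j) by case: (projT2 j).
have apsi j : tb_atlas (psi j) by case: (projT2 j).
pose U j := dom (t (phi j)) `&` dom (t' (psi j)).
have UP j x : U j x -> dom (phi j) x /\ dom (psi j) x.
  by rewrite /U domt // domt'.
pose h j x (i : discrete_topology 'I_n) : discrete_topology 'I_n :=
  support_perm (fibre_map (phi j) (psi j) f x) i.
pose h' j x (i : discrete_topology 'I_n) : discrete_topology 'I_n :=
  support_perm (fibre_map (psi j) (phi j) f' x) i.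
suff [F hF _] : exists2 F, homeo_over (@cov_proj _ _ Y) (@cov_proj _ _ Y') F &
    forall j e, U j (cov_proj e) ->
      F e = of_prod (t' (psi j))
        (cov_proj e, h j (cov_proj e) (to_prod (t (phi j)) e).2) by exists F.
apply: (@glue_homeos _ _ _ _ _ _ _ J _ _ h h').
- exact: cov_proj_continuous.
- exact: cov_proj_continuous.
- move=> x; have [a aa xa] := @tb_atlas_cover _ _ _ E x.
  have [b ab xb] := @tb_atlas_cover _ _ _ E' x.
  exists (exist _ (a, b) (conj aa ab)); split; first by rewrite /phi /= domt.
  by rewrite /psi /= domt'.
- move=> j x i /UP[xphi xpsi]; apply: discrete_prod_continuous.
  have := near_support_perm_fibre_map hf (aphi j) (apsi j) xphi xpsi.
  by apply: filterS => y gy; apply/funext => k; congr (fun_of_perm _ _).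
- move=> j x i /UP[xphi xpsi]; apply: discrete_prod_continuous.
  have := near_support_perm_fibre_map hf' (apsi j) (aphi j) xpsi xphi.
  by apply: filterS => y gy; apply/funext => k; congr (fun_of_perm _ _).
- move=> j x /UP[xphi xpsi] i; rewrite /h' /h -support_perm_fibre_map_comp //.
  rewrite -[RHS](@support_perm_id R n).
  congr (support_perm _ _); apply/funext => v.
  by rewrite /fibre_map /= fK of_prodK.
- move=> j x /UP[xphi xpsi] i; rewrite /h' /h -support_perm_fibre_map_comp //.
  rewrite -[RHS](@support_perm_id R n).
  congr (support_perm _ _); apply/funext => v.
  by rewrite /fibre_map /= f'K of_prodK.
- move=> j k x i /UP[xphij xpsij] /UP[xphik xpsik].
  (* Both sides are the permutation of [f] read from [phi j] to [psi k], factored through [phi k] or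
     through [psi j]. *)
  rewrite transt // transt' // /h.
  transitivity (support_perm (fibre_map (phi j) (psi k) f x) i).
    exact: (esym (support_perm_fibre_map_comp i (tb_homeo_id E) hf
      (aphi j) (aphi k) (apsi k) xphij xphik xpsik)).
  exact: (support_perm_fibre_map_comp i hf (tb_homeo_id E')
    (aphi j) (apsi j) (apsi k) xphij xpsij xpsik).
Qed.

Definition transport_triv (E E' F : topologicalType) (p : E -> X) (p' : E' -> X)
    (f : E -> E') (g : E' -> E) (cf : continuous f) (cg : continuous g)
    (fK : cancel f g) (gK : cancel g f) (pf : forall e, p' (f e) = p e)
    (pg : forall e, p (g e) = p' e) (cp : continuous p) (cp' : continuous p')
    (phi : local_triv F p) :
  local_triv F p'.
Proof.
apply: (@LocalTriv X E' F p' (dom phi)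
  (to_prod phi \o g) (f \o of_prod phi)) => //.
- exact: dom_open.
- rewrite continuous_open_subspace; last first.
    by apply: open_comp; [move=> ? _; exact: cp'|exact: dom_open].
  move=> e; rewrite inE => ed; apply: continuous_comp; first exact: cg.
  by apply: to_prod_continuous_at => //=; rewrite pg.
- have -> : dom phi `*` setT = fst @^-1` dom phi :> set (X * F).
    by apply/seteqP; split=> [y []|y].
  rewrite continuous_open_subspace; last first.
    by apply: open_comp => [e _|]; [exact: cvg_fst|exact: dom_open].
  move=> z; rewrite inE => zd; apply: continuous_comp; last exact: cf.
  exact: of_prod_continuous_at.
- by move=> e ed /=; rewrite to_prod_over pg.
- by move=> z zd /=; rewrite pf of_prod_over.
- by move=> e ed /=; rewrite to_prodK ?pg // gK.
- by move=> z zd /=; rewrite fK of_prodK.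
Defined.

Lemma associated_cov_iso E Y Y' :
  associated E Y -> cov_iso Y Y' -> associated E Y'.
Proof.
move=> [t [domt transt]] [f /[dup] hf /homeo_over_sym[g [[cg _ pg] fK gK]]].
have [cf _ pf] := hf.
exists (fun phi => transport_triv cf cg fK gK pf pg
  (@cov_proj_continuous _ _ Y) (@cov_proj_continuous _ _ Y') (t phi)).
split=> [phi /domt <- //|phi psi aphi apsi x xphi xpsi i].
rewrite -[RHS]transt //.
by rewrite /transition /fibre_map /= fK.
Qed.

Lemma cov_iso_refl Y : cov_iso Y Y.
Proof. by exists id; exact: homeo_over_id. Qed.

Lemma cov_iso_sym Y Y' : cov_iso Y Y' -> cov_iso Y' Y.
Proof. by move=> [f /homeo_over_sym[g [hg _ _]]]; exists g. Qed.

Lemma cov_iso_trans Y Y' Y'' : cov_iso Y Y' -> cov_iso Y' Y'' -> cov_iso Y Y''.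
Proof.
by move=> [f hf] [g hg]; exists (g \o f); exact: homeo_over_comp hf hg.
Qed.

(** Supplies the default value for a choice of charts; over an empty base all the data are
    vacuous. *)
Lemma local_triv_inhabited Y :
  inhabited (local_triv (discrete_topology 'I_n) (@cov_proj _ _ Y)).
Proof.
have [[x _]|noX] := pselect (exists x : X, True).
  by have [phi _] := @cov_triv _ _ Y x; exact: (inhabits phi).
have absX : forall A : Type, X -> A.
  by move=> A x; have [] : False by apply: noX; exists x.
apply: inhabits; apply: (@LocalTriv X (cov_total Y) (discrete_topology 'I_n)
  (@cov_proj _ _ Y) setT (fun e => absX _ (cov_proj e)) (fun z => absX _ z.1)).
- exact: openT.
- by move=> e; exact: (absX _ (cov_proj (e : cov_total Y))).
- by move=> z; exact: (absX _ (z : X * discrete_topology 'I_n).1).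
- by move=> e; exact: (absX _ (cov_proj e)).
- by move=> z; exact: (absX _ z.1).
- by move=> e; exact: (absX _ (cov_proj e)).
- by move=> z; exact: (absX _ z.1).
Qed.

(* The bundle of T-valued functions on the fibres of the covering. *)
Lemma covering_associated Y : exists E, associated E Y.
Proof.
pose cp := @cov_proj_continuous _ _ Y.
pose I := local_triv (discrete_topology 'I_n) (@cov_proj _ _ Y).
(* Functions on the fibre pull back, so coordinates change along the inverse transition, from [j] to
   [i]. *)
pose g (i j : I) x (v : 'cV[trop R]_n) : 'cV[trop R]_n :=
  \col_k v (transition j i x k) 0.
have transD (i j k : I) x l : dom i x -> dom j x -> dom k x ->
    transition j k x (transition i j x l) = transition i k x l.
  move=> ix jx kx; rewrite /transition.
  exact/esym/(@fibre_map_comp _ _ _ _ _ _ _ _ i j k id id).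
have transK (i j : I) x : dom i x -> dom j x ->
    cancel (transition i j x) (transition j i x).
  by move=> ix jx k; rewrite transD // transition_id.
have [||||| E [p [chart [cE domE chartE]]]] :=
  @glue_spaces I X 'cV[trop R]_n (@dom _ _ _ _) g.
- exact: dom_open.
- exact: cov_triv.
- by move=> i x v ix; apply/matrixP => k l; rewrite !mxE transition_id // ord1.
- by move=> i j k x v ix jx kx; apply/matrixP => l m; rewrite !mxE transD.
- move=> i j x v ix jx; apply: mx_cvg => k l.
  pose f (z : X * 'cV[trop R]_n) := z.2 (transition j i x k) 0.
  (* Near [x] the transition is constant, so the entry is locally a fixed coordinate of [v]. *)
  suff : f z @[z --> (x, v)] --> g i j x v k l.
    apply: cvg_trans; apply: near_eq_cvg.
    have : \forall y \near x, transition j i y = transition j i x.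
      by apply: near_fibre_map_discrete => // y; exact: cvg_id.
    move=> /(@cvg_fst _ _ (nbhs x) (nbhs v)) nearE.
    apply: (@filterS _ (nbhs (x, v)) _ _ _ _ nearE) => z /= zE.
    by rewrite mxE zE.
  by rewrite mxE; exact: snd_coord_cvg.
have atlas_cover x : exists2 phi, range chart phi & dom phi x.
  by have [i ix] := @cov_triv _ _ Y x; exists (chart i) => //; rewrite domE.
have atlas_linear phi psi : range chart phi -> range chart psi ->
    forall x, dom phi x -> dom psi x -> trop_linear (transition phi psi x).
  move=> [i _ <-] [j _ <-] x; rewrite !domE => ix jx.
  have -> : transition (chart i) (chart j) x = g i j x.
    by apply/funext => v; exact: chartE.
  by split=> [a u|u v]; apply/matrixP => k l; rewrite !mxE.
pose B := TBundle cE atlas_cover atlas_linear; exists B.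
have [i0] := local_triv_inhabited Y.
have /choice[t tP] : forall phi, exists i, range chart phi -> chart i = phi.
  move=> phi; have [[i _ iE]|nphi] := pselect (range chart phi).
    by exists i.
  by exists i0.
exists t; split=> [phi aphi|phi psi aphi apsi x xphi xpsi k].
  by rewrite -{2}(tP _ aphi) domE.
have [xi xj] : dom (t phi) x /\ dom (t psi) x by rewrite -!domE !tP.
apply/eqP; rewrite -[gl_perm _]/(support_perm (transition phi psi x)).
rewrite -trop_iso_delta; last exact: (fibre_map_iso (tb_homeo_id B)).
(* The image of the k-th basis vector has entry 1 at the transition of [k], because the pulled-back
   index is [k] again. *)
rewrite -{1}(tP _ aphi) -{1}(tP _ apsi) chartE // !mxE transK // eqxx.
exact: oner_neq0.
Qed.

End Associated.
(** * Bundles with trivial covering *)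

Section Trivial.
Variables (R : realType) (X : topologicalType) (n : nat).
Local Notation T := (trop R).

Lemma trivial_associated :
  associated (trivial_tbundle R X n) (trivial_covering X n).
Proof.
exists (fun=> prod_triv X (discrete_topology 'I_n)).
split=> [_ -> //|_ _ -> -> x _ _ i].
apply/esym; rewrite -[RHS](@support_perm_id R n); congr (support_perm _ _).
Qed.

Section Trivialization.
Variables (E : tbundle R X n).
Variable t : local_triv 'cV[T]_n (@tb_proj _ _ _ E) ->
  local_triv (discrete_topology 'I_n) (@cov_proj _ _ (trivial_covering X n)).
Hypothesis domt : forall phi, tb_atlas phi -> dom (t phi) = dom phi.
Hypothesis transt : forall phi psi, tb_atlas phi -> tb_atlas psi ->
  forall x, dom phi x -> dom psi x -> forall i,
    transition (t phi) (t psi) x i = gl_perm (transition_mx phi psi x) i.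

Let J := {phi : local_triv 'cV[T]_n (@tb_proj _ _ _ E) | tb_atlas phi}.
Let chart (j : J) := projT1 j.
Let atlasP j : tb_atlas (chart j) := projT2 j.
Let std : local_triv (discrete_topology 'I_n)
  (@cov_proj _ _ (trivial_covering X n)) := prod_triv X _.

(* sheet j x i is the index, in the chart j, of the line of the fibre over x
   that lies on the i-th sheet of the trivial covering. *)
Let sheet j x (i : 'I_n) : 'I_n := transition std (t (chart j)) x i.
Let unsheet j x (i : 'I_n) : 'I_n := transition (t (chart j)) std x i.

Let near_sheet j x :
  dom (chart j) x -> \forall y \near x, sheet j y = sheet j x.
Proof.
move=> xj; apply: near_fibre_map_discrete; rewrite ?domt //.
  exact: cov_proj_continuous.
by move=> y; exact: cvg_id.
Qed.

Let near_unsheet j x :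
  dom (chart j) x -> \forall y \near x, unsheet j y = unsheet j x.
Proof.
move=> xj; apply: near_fibre_map_discrete; rewrite ?domt //.
  exact: cov_proj_continuous.
by move=> y; exact: cvg_id.
Qed.

Let sheetK j x : dom (chart j) x -> cancel (sheet j x) (unsheet j x).
Proof.
move=> xj; have tx : dom (t (chart j)) x by rewrite domt.
exact: (@fibre_map_cancel _ _ _ _ _ _ std (t (chart j)) id id x).
Qed.

Let unsheetK j x : dom (chart j) x -> cancel (unsheet j x) (sheet j x).
Proof.
move=> xj; have tx : dom (t (chart j)) x by rewrite domt.
exact: (@fibre_map_cancel _ _ _ _ _ _ (t (chart j)) std id id x).
Qed.

Let sheetD j k x i : dom (chart j) x -> dom (chart k) x ->
  sheet k x i = support_perm (transition (chart j) (chart k) x) (sheet j x i).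
Proof.
move=> xj xk; rewrite -[RHS]transt //.
have tx : dom (t (chart j)) x by rewrite domt.
exact: (@fibre_map_comp _ _ _ _ _ _ _ _ std (t (chart j)) (t (chart k)) id id).
Qed.

Let isotr j k x : dom (chart j) x -> dom (chart k) x ->
  trop_iso (transition (chart j) (chart k) x).
Proof. exact: (fibre_map_iso (tb_homeo_id E) (atlasP j) (atlasP k)). Qed.

(** The factor by which the change of chart scales the line on sheet [i]; numbering lines by sheets
    turns the monomial cocycle into [n] scalar ones. *)
Let coef i j k x : T :=
  transition (chart j) (chart k) x (delta_mx (sheet j x i) 0) (sheet k x i) 0.

Let coefE i j k x v : dom (chart j) x -> dom (chart k) x ->
  transition (chart j) (chart k) x v (sheet k x i) 0 =
  coef i j k x * v (sheet j x i) 0.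
Proof.
by move=> xj xk; rewrite /coef (sheetD i xj xk) trop_isoE //; exact: isotr.
Qed.

Let coef_neq0 i j k x : dom (chart j) x -> dom (chart k) x -> coef i j k x != 0.
Proof.
move=> xj xk; rewrite /coef (sheetD i xj xk).
by rewrite support_perm_neq0 //; exact: isotr.
Qed.

Let coefD i j k l x : dom (chart j) x -> dom (chart k) x -> dom (chart l) x ->
  coef i j l x = coef i k l x * coef i j k x.
Proof.
move=> xj xk xl; rewrite -[RHS](coefE i
  (transition (chart j) (chart k) x (delta_mx (sheet j x i) 0)) xk xl).
congr (fun_of_matrix _ _ _).
exact: (@fibre_map_comp _ _ _ _ _ _ _ _ (chart j) (chart k) (chart l) id id).
Qed.

(** Near [x] the sheet indices are constant, so [coef] is locally one fixed entry of the transition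
    matrix. *)
Let coef_continuous i j k x : dom (chart j) x -> dom (chart k) x ->
  {for x, continuous (fun y => trop_fin (coef i j k y))}.
Proof.
move=> xj xk; apply: (@trop_fin_cvg _ _ _ (coef i j k)); first exact: coef_neq0.
pose v : 'cV[T]_n := delta_mx (sheet j x i) 0.
apply: (cvg_trans
  (G := transition (chart j) (chart k) y v (sheet k x i) 0 @[y --> x])).
  apply: near_eq_cvg; have := near_sheet xj; have := near_sheet xk.
  by apply: filterS2 => y /(congr1 (@^~ i)) /= yk /(congr1 (@^~ i)) /= yj;
    rewrite /coef yk yj.
have ctr : {for x, continuous (fun y => transition (chart j) (chart k) y v)}.
  apply: (@continuous_comp _ _ _ (fun y : X => (y, v))
    (fun z => transition (chart j) (chart k) z.1 z.2)).
    exact: pair_cst_continuous.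
  apply: fibre_map_continuous => //; first exact: tb_proj_continuous.
  by move=> y; exact: cvg_id.
apply: (@continuous_comp _ _ _ (fun y => transition (chart j) (chart k) y v)
  (fun M : 'cV[T]_n => M (sheet k x i) 0)) => //.
exact: mx_coord_continuous.
Qed.

Lemma trivial_tbundle_of_sheets : paracompact X -> hausdorff_space X ->
  tb_iso E (trivial_tbundle R X n).
Proof.
move=> pcX hX.
have cover x : exists j : J, dom (chart j) x.
  have [phi aphi xphi] := @tb_atlas_cover _ _ _ E x.
  by exists (exist _ phi aphi).
have /choice[b bP] : forall i : 'I_n, exists b : J -> X -> R,
    (forall j x, dom (chart j) x -> {for x, continuous (b j)}) /\
    (forall j k x, dom (chart j) x -> dom (chart k) x ->
       b k x = b j x + trop_fin (coef i j k x)).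
  move=> i; apply: (continuous_cocycle_split pcX hX) => //.
  - by move=> j; exact: dom_open.
  - by move=> j k x; exact: coef_continuous.
  - move=> j k l x xj xk xl; rewrite (coefD i xj xk xl) trop_finM ?coef_neq0 //.
    exact: addrC.
(* Coordinates are sorted by sheet and rescaled by [- b], the sign that cancels the growth of [b k]
   over [b j] by the cocycle; [h'] undoes both. *)
pose h j x (v : 'cV[T]_n) : 'cV[T]_n :=
  \col_i (trop_of (- b i j x) * v (sheet j x i) 0).
pose h' j x (v : 'cV[T]_n) : 'cV[T]_n :=
  \col_l (trop_of (b (unsheet j x l) j x) * v (unsheet j x l) 0).
pose ptriv : local_triv 'cV[T]_n (@tb_proj _ _ _ (trivial_tbundle R X n)) :=
  prod_triv X _.
have UP j x : (dom (chart j) `&` dom ptriv) x -> dom (chart j) x by case.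
have [| | |j x v /UP xj|j x v /UP xj|j x /UP xj v|j x /UP xj v|
    j k x v /UP xj /UP xk|f hf fE] :=
  @glue_homeos X _ _ _ _ (@tb_proj _ _ _ E)
    (@tb_proj _ _ _ (trivial_tbundle R X n)) J chart (fun=> ptriv) h h'.
- exact: tb_proj_continuous.
- exact: tb_proj_continuous.
- by move=> x; have [j xj] := cover x; exists j.
- apply: mx_cvg => i l.
  pose f (z : X * 'cV[T]_n) := trop_of (- b i j z.1) * z.2 (sheet j x i) 0.
  suff : f z @[z --> (x, v)] --> h j x v i l.
    apply: cvg_trans; apply: near_eq_cvg.
    have /(@cvg_fst _ _ (nbhs x) (nbhs v)) nearE := near_sheet xj.
    apply: (@filterS _ (nbhs (x, v)) _ _ _ _ nearE) => z /= zE.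
    by rewrite mxE zE.
  rewrite mxE; apply: trop_mul_cvg; last exact: snd_coord_cvg.
  apply: trop_of_cvg; apply: cvgN; apply: fst_comp_cvg.
  by have [+ _] := bP i; apply.
- apply: mx_cvg => i l; pose m := unsheet j x i.
  pose f (z : X * 'cV[T]_n) := trop_of (b m j z.1) * z.2 m 0.
  suff : f z @[z --> (x, v)] --> h' j x v i l.
    apply: cvg_trans; apply: near_eq_cvg.
    have /(@cvg_fst _ _ (nbhs x) (nbhs v)) nearE := near_unsheet xj.
    apply: (@filterS _ (nbhs (x, v)) _ _ _ _ nearE) => z /= zE.
    by rewrite mxE zE.
  rewrite mxE; apply: trop_mul_cvg; last exact: snd_coord_cvg.
  apply: trop_of_cvg; apply: fst_comp_cvg.
  by have [+ _] := bP m; apply.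
- apply/matrixP => i l; rewrite !mxE unsheetK // !mulrA -trop_ofD.
  by rewrite subrr trop_of0 mul1r ord1.
- apply/matrixP => i l; rewrite !mxE sheetK // !mulrA -trop_ofD.
  by rewrite addNr trop_of0 mul1r ord1.
(* The target has a single chart, so compatibility says that [h k] after the transition is [h j]; on
   scalars, [- b k] plus the cocycle equals [- b j]. *)
- have -> : transition ptriv ptriv x (h j x v) = h j x v by [].
  apply/matrixP => i l; rewrite !mxE coefE // mulrA; congr (_ * _).
  have [_ /(_ j k x xj xk) ->] := bP i.
  rewrite -{2}(trop_finK (coef_neq0 i xj xk)) -trop_ofD; congr (trop_of _).
  by rewrite opprD addrNK.
exists f => // phi _ aphi -> x xphi _.
pose j : J := exist _ phi aphi.
have -> : fibre_map phi (prod_triv X _) f x = h j x.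
  apply/funext => v; rewrite /fibre_map (fE j) /= of_prod_over //.
  by rewrite of_prodK.
split=> [a u|u v]; apply/matrixP => i l; rewrite !mxE; first by rewrite mulrCA.
by rewrite mulrDr.
Qed.

End Trivialization.
End Trivial.

(** * Isomorphism classes and the map between them *)

Lemma clsE (T : Type) (r : T -> T -> Prop) (x y : T) :
  (forall z, r z z) -> (forall z w, r z w -> r w z) ->
  (forall z w u, r z w -> r w u -> r z u) ->
  cls r x = cls r y <-> r x y.
Proof.
move=> rr rs rt; split=> [/(congr1 (@proj1_sig _ _)) /= rxy|rxy].
  by rewrite rxy.
apply: eq_exist; apply/funext => z; apply/propext; split=> [|/(rt _ _ _ rxy)//].
exact: rt (rs _ _ rxy).
Qed.

Lemma quot_cls (T : Type) (r : T -> T -> Prop) (q : quot r) :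
  exists x, q = cls r x.
Proof. by case: q => C [x Cx]; exists x; exact: eq_exist. Qed.

Theorem theoremC (R : realType) (X : topologicalType) (n : nat)
  (lcX : locally_connected X) (pcX : paracompact X) (hX : hausdorff_space X) :
  exists Phi : tbundle_classes R X n -> covering_classes X n,
    [/\ forall (E : tbundle R X n) (Y : covering X n),
          associated E Y <-> Phi (tb_class E) = cov_class Y,
        exists Psi : covering_classes X n -> tbundle_classes R X n,
          cancel Psi Phi
      & forall E : tbundle R X n,
          tb_iso E (trivial_tbundle R X n) <->
          Phi (tb_class E) = cov_class (trivial_covering X n)].
Proof.
have tbE (E E' : tbundle R X n) : tb_class E = tb_class E' <-> tb_iso E E'.
  by apply: clsE; [exact: tb_iso_refl|exact: tb_iso_sym|exact: tb_iso_trans].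
have covE (Y Y' : covering X n) : cov_class Y = cov_class Y' <-> cov_iso Y Y'.
  by apply: clsE; [exact: cov_iso_refl|exact: cov_iso_sym|exact: cov_iso_trans].
(* The property is required for every representative [E] of the class, so the chosen value does not
   depend on a representative. *)
have /choice[Phi PhiP] : forall q : tbundle_classes R X n,
    exists C : covering_classes X n, forall E Y, q = tb_class E ->
      (associated E Y <-> C = cov_class Y).
  move=> q; have [E0 ->] := quot_cls q; have [Y0 E0Y0] := associated_exists E0.
  exists (cov_class Y0) => E Y /tbE E0E; split=> [EY|/covE Y0Y].
    exact/covE/(associated_unique E0E).
  have [Y1 EY1] := associated_exists E; apply: (associated_cov_iso EY1).
  exact: cov_iso_trans (cov_iso_sym (associated_unique E0E E0Y0 EY1)) Y0Y.
have assocE E Y : associated E Y <-> Phi (tb_class E) = cov_class Y.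
  exact: PhiP.
exists Phi; split=> // [|E].
  suff /choice[Psi PsiK] : forall q : covering_classes X n,
      exists E, Phi E = q by exists Psi.
  move=> q; have [Y ->] := quot_cls q; have [E EY] := covering_associated R Y.
  by exists (tb_class E); apply/assocE.
split=> [/tbE ->|]; first exact/assocE/trivial_associated.
(* Equality of classes yields charts [t] on the trivial covering itself, hence a global numbering of
   the lines. *)
move=> /assocE[t [domt transt]].
exact: trivial_tbundle_of_sheets domt transt pcX hX.
Qed.
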